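(* Let $p,q,r$ be integers with $1\le p\le q\le r\le 2q$. For integers $p',q',r'$, let $\min(p',q',r';|V|)$ denote the minimum of $|V(G)|$ over all connected finite simple graphs $G$ with $\mathrm{ind\text{-}match}(G)=p'$, $\mathrm{min\text{-}match}(G)=q'$ and $\mathrm{match}(G)=r'$. Then: (1) $\min(1,q,r;|V|)=2r$; (2) $\min(p,q,r;|V|)=2r$ if $2\le p\le q<r\le 2q$; (3) $\min(p,r,r;|V|)=2r+1$ if $2\le p\le q=r$.
   Context: All graphs are finite and simple. A matching of $G$ is a set of pairwise disjoint edges. A maximal matching is a matching not properly contained in another matching. An induced matching is a matching $M$ such that for distinct $e,f\in M$ there is no edge $g$ of $G$ meeting both $e$ and $f$. $\mathrm{match}(G)$ is the maximum size of a matching, $\mathrm{min\text{-}match}(G)$ the minimum size of a maximal matching, and $\mathrm{ind\text{-}match}(G)$ the maximum size of an induced matching of $G$. For every $1\le p\le q\le r\le 2q$ there exists a connected graph with these three invariants equal to $p,q,r$. *)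

(* Defs.v *)
From mathcomp Require Import all_boot.

Set Implicit Arguments.
Unset Strict Implicit.
Unset Printing Implicit Defensive.

Record sgraph := SGraph {
  vertex :> finType;
  adj : rel vertex;
  adj_sym : symmetric adj;
  adj_irr : irreflexive adj
}.

(* The null graph is not connected. *)
Definition connected (G : sgraph) : bool :=
  (0 < #|G|) && [forall x : G, forall y : G, connect (@adj G) x y].

Definition edges (G : sgraph) : {set {set G}} :=
  [set e : {set G} | [exists x : G, exists y : G, adj x y && (e == [set x; y])]].

Definition matching (G : sgraph) (M : {set {set G}}) : bool :=
  (M \subset edges G) && trivIset M.

Definition maximal_matching (G : sgraph) (M : {set {set G}}) : bool :=
  maxset (@matching G) M.

Definition induced_matching (G : sgraph) (M : {set {set G}}) : bool :=
  matching M &&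
  [forall e in M, forall f in M, (e != f) ==>
     ~~ [exists g in edges G, (g :&: e != set0) && (g :&: f != set0)]].

Lemma matching0 (G : sgraph) : matching (set0 : {set {set G}}).
Proof. by rewrite /matching sub0set; apply/trivIsetP => A B; rewrite inE. Qed.

Lemma maximal_matching_size_ex (G : sgraph) :
  exists n, [exists M : {set {set G}}, maximal_matching M && (#|M| == n)].
Proof.
have [M maxM _] := maxset_exists (matching0 G).
by exists #|M|; apply/existsP; exists M; rewrite /maximal_matching maxM /=.
Qed.

Definition match_num (G : sgraph) : nat :=
  \max_(M : {set {set G}} | matching M) #|M|.

Definition min_match (G : sgraph) : nat := ex_minn (maximal_matching_size_ex G).

Definition ind_match (G : sgraph) : nat :=
  \max_(M : {set {set G}} | induced_matching M) #|M|.

Definition is_minimum (S : nat -> Prop) (n : nat) : Prop :=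
  S n /\ forall m, S m -> n <= m.

Definition realized_order (p q r n : nat) : Prop :=
  exists G : sgraph,
    [/\ connected G, ind_match G = p, min_match G = q, match_num G = r
      & #|G| = n].

(* [is_min_order p q r n] reads "min(p, q, r; |V|) exists and equals n". *)
Definition is_min_order (p q r n : nat) : Prop :=
  is_minimum (realized_order p q r) n.

(* Main.v *)
(* A matching of size [r] needs [2r] vertices. For the realizations, join an
   independent set of order [s] to a disjoint union of [p] even cliques on
   [2q] vertices in total. The vertices missed by a maximal matching [M]
   either all lie in the independent set, or lie in distinct cliques; in the
   latter case parity gives an edge of [M] from each of these cliques to the
   independent set. So [M] misses at most [s] vertices and has at least [q]
   edges. Take [s = 2(r - q)] in (1) and (2), and [s = 1] in (3).
   For the lower bound in (3), suppose that all maximal matchings are perfect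
   and that [ab], [cd] form an induced matching. By connectedness one may
   choose them with a vertex [v] adjacent to [b] and [c]. Let [vw] be the edge
   at [v] in a perfect matching containing [ab] and [cd]. Replacing [cd], [vw]
   by [vc] forces [dw] to be an edge, and then replacing [ab], [cd], [vw] by
   [vb], [dw] forces [ac] to be an edge, a contradiction. *)
Require Import Defs.
From mathcomp Require Import all_boot.

Set Implicit Arguments.
Unset Strict Implicit.
Unset Printing Implicit Defensive.

(** * Counting through a relation, and covers of enlarged families *)

(** Choosing a related index for each element of [A] gives an injection. Stated for a relation so
    that no function has to be exhibited when it is used. *)
Lemma leq_card_rel (T I : finType) (A : {set T}) (R : T -> I -> bool) :
    (forall u, u \in A -> exists j, R u j) ->
    (forall u v j, u \in A -> v \in A -> R u j -> R v j -> u = v) ->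
  #|A| <= #|I|.
Proof.
move=> exR injR; have [->|[u0 u0A]] := set_0Vmem A; first by rewrite cards0.
(* An element of [A] provides the default value [j0] that makes [g] total. *)
have [j0 _] := exR _ u0A.
pose g u := odflt j0 [pick j | R u j].
have gP u : u \in A -> R u (g u).
  move=> uA; rewrite /g; case: pickP => //= noR.
  by have [j] := exR _ uA; rewrite noR.
apply: (@leq_card_in _ _ g) => u v uA vA guv.
by apply: (injR u v (g u)) => //; [exact: gP | rewrite guv; exact: gP].
Qed.

Lemma mem_coverU1 (T : finType) (e : {set T}) (M : {set {set T}}) z :
  (z \in cover (e |: M)) = (z \in e) || (z \in cover M).
Proof.
apply/bigcupP/orP => [[f]|[ze|/bigcupP[f fM zf]]].
- rewrite !inE => /orP[/eqP-> ze|fM zf]; first by left.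
  by right; apply/bigcupP; exists f.
- by exists e; rewrite ?setU11.
- by exists f => //; rewrite setU1r.
Qed.

(** * Matchings, maximal matchings and induced matchings of a graph *)

Section Matchings.
Variable G : sgraph.
Implicit Types (M N : {set {set G}}) (e f : {set G}) (x y z : G).

Lemma edgesP e :
  reflect (exists x y, adj x y /\ e = [set x; y]) (e \in edges G).
Proof.
rewrite inE; apply: (iffP existsP) => -[x].
  by case/existsP=> y /andP[xy /eqP->]; exists x, y.
by case=> y [xy ->]; exists x; apply/existsP; exists y; rewrite xy eqxx.
Qed.

Lemma edge_adj x y : adj x y -> [set x; y] \in edges G.
Proof. by move=> xy; apply/edgesP; exists x, y. Qed.

Lemma adj_neq x y : adj x y -> x != y.
Proof. by apply: contraTneq => ->; rewrite adj_irr. Qed.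

Lemma card_edge e : e \in edges G -> #|e| = 2.
Proof. by case/edgesP=> x [y [/adj_neq xy ->]]; rewrite cards2 xy. Qed.

Lemma matching_edge M e : matching M -> e \in M -> e \in edges G.
Proof. by case/andP=> /subsetP sM _ /sM. Qed.

Lemma edge_ends e x y : e \in edges G -> x \in e -> y \in e -> x != y ->
  adj x y /\ e = [set x; y].
Proof.
case/edgesP=> u [v [uv ->]]; rewrite !inE => /orP[]/eqP-> /orP[]/eqP->;
  rewrite ?eqxx // => _; split=> //; first by rewrite adj_sym.
by rewrite setUC.
Qed.

Lemma matching_inj M e f z :
  matching M -> e \in M -> f \in M -> z \in e -> z \in f -> e = f.
Proof.
case/andP=> _ /trivIsetP tM eM fM ze zf; apply/eqP/negPn/negP => /tM-/(_ eM fM).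
by move/disjoint_setI0/setP/(_ z); rewrite !inE ze zf.
Qed.

Lemma matchingI M :
    (forall e, e \in M -> e \in edges G) ->
    (forall e f z, e \in M -> f \in M -> z \in e -> z \in f -> e = f) ->
  matching M.
Proof.
move=> sM dM; apply/andP; split; first exact/subsetP.
apply/trivIsetP => e f eM fM; apply: contraNT => /pred0Pn[z /andP[ze zf]].
exact/eqP/(dM _ _ z).
Qed.

Lemma matchingS M N : N \subset M -> matching M -> matching N.
Proof.
move=> sNM /andP[sM tM]; apply/andP; split; first exact: subset_trans sM.
exact: trivIsetS tM.
Qed.

Lemma matchingU1 M x y : matching M -> adj x y ->
  x \notin cover M -> y \notin cover M -> matching ([set x; y] |: M).
Proof.
move=> mM xy xM yM.
have disj f z : f \in M -> z \in [set x; y] -> z \in f -> False.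
  move=> fM zxy zf; have zM : z \in cover M by apply/bigcupP; exists f.
  by move: zxy; rewrite !inE => /orP[]/eqP zE; rewrite -zE zM in xM yM.
apply: matchingI => [e|e f z].
  by case/setU1P=> [->|/(matching_edge mM)//]; exact: edge_adj.
case/setU1P=> [->|eM]; case/setU1P=> [->|fM] // ze zf.
- by case: (disj _ _ fM ze zf).
- by case: (disj _ _ eM zf ze).
- exact: (matching_inj mM eM fM ze zf).
Qed.

Lemma card_cover_matching M : matching M -> #|cover M| = 2 * #|M|.
Proof.
move=> mM; have /andP[_] := mM; rewrite /trivIset => /eqP<-.
rewrite mulnC -sum_nat_const; apply: eq_bigr => e eM.
exact/card_edge/(matching_edge mM).
Qed.

(** An edge with both ends uncovered could be added to [M]. Conversely, an edge of a larger matching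
    has an end covered by [M], hence shares it with an edge of [M] and equals that edge. *)
Lemma maximal_matchingP M :
  reflect (matching M /\
           forall x y, adj x y -> (x \in cover M) || (y \in cover M))
          (maximal_matching M).
Proof.
apply: (iffP (@maxsetP _ _ _)) => -[mM maxM]; split=> //.
  move=> x y xy; apply/norP => -[xM yM].
  have /setP/(_ [set x; y]) := maxM _ (matchingU1 mM xy xM yM) (subsetUr _ _).
  rewrite setU11 => xyM; case/bigcupP: xM; exists [set x; y] => //.
  by rewrite set21.
move=> N mN sMN; apply/eqP; rewrite eqEsubset sMN andbT; apply/subsetP => e eN.
have /edgesP[x [y [xy eE]]] := matching_edge mN eN.
have eM z : z \in e -> z \in cover M -> e \in M.
  move=> ze /bigcupP[f fM zf].
  by rewrite (matching_inj mN eN (subsetP sMN _ fM) ze zf).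
by case/orP: (maxM _ _ xy) => /eM; apply; rewrite eE ?set21 ?set22.
Qed.

(** An edge meeting both [e] and [f] either has one end in each or has an end common to both; in the
    latter case disjointness already gives [e = f]. *)
Lemma induced_matchingP M :
  reflect (matching M /\
           forall e f x y, e \in M -> f \in M -> x \in e -> y \in f ->
             adj x y -> e = f)
          (induced_matching M).
Proof.
apply: (iffP andP) => -[mM indM]; split=> //.
  move=> e f x y eM fM xe yf xy; apply/eqP/negPn/negP => nef.
  have /existsP[] := implyP (forall_inP (forall_inP indM e eM) f fM) nef.
  exists [set x; y]; rewrite edge_adj //=.
  by apply/andP; split; apply/set0Pn; [exists x | exists y];
    rewrite !inE eqxx ?orbT.
apply/forall_inP => e eM; apply/forall_inP => f fM; apply/implyP => nef.
apply/existsP => -[g /and3P[/edgesP[x [y [xy ->]]]]].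
case/set0Pn=> z /setIP[zxy ze] /set0Pn[w /setIP[wxy wf]]; case/eqP: nef.
move: zxy wxy; rewrite !inE => /orP[]/eqP zE /orP[]/eqP wE; subst z w.
- exact: (matching_inj mM eM fM ze).
- exact: (indM _ _ _ _ eM fM ze wf).
- by apply: (indM _ _ _ _ eM fM ze wf); rewrite adj_sym.
- exact: (matching_inj mM eM fM ze).
Qed.

(** * The three invariants as attained extrema *)

Lemma min_match_leq M : maximal_matching M -> min_match G <= #|M|.
Proof.
rewrite /min_match; case: ex_minnP => n _ minn maxM; apply: minn.
by apply/existsP; exists M; rewrite maxM eqxx.
Qed.

Lemma min_match_attained :
  exists2 M : {set {set G}}, maximal_matching M & #|M| = min_match G.
Proof.
rewrite /min_match; case: ex_minnP => n /existsP[M /andP[maxM /eqP cM]] _.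
by exists M.
Qed.

Lemma leq_match_num M : matching M -> #|M| <= match_num G.
Proof. exact: (@leq_bigmax_cond _ (@matching G) (fun M => #|M|)). Qed.

Lemma match_num_attained :
  exists2 M : {set {set G}}, matching M & #|M| = match_num G.
Proof.
have [|M mM cM] := @eq_bigmax_cond _ (@matching G) (fun M => #|M|).
  by apply/card_gt0P; exists set0; exact: matching0.
by exists M; last exact: esym cM.
Qed.

Lemma leq_ind_match M : induced_matching M -> #|M| <= ind_match G.
Proof. exact: (@leq_bigmax_cond _ (@induced_matching G) (fun M => #|M|)). Qed.

Lemma ind_match_attained :
  exists2 M : {set {set G}}, induced_matching M & #|M| = ind_match G.
Proof.
have [|M mM cM] := @eq_bigmax_cond _ (@induced_matching G) (fun M => #|M|).
  apply/card_gt0P; exists set0; apply/induced_matchingP.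
  by split=> [|e f x y]; rewrite ?inE //; exact: matching0.
by exists M; last exact: esym cM.
Qed.

Lemma min_match_le_match_num : min_match G <= match_num G.
Proof.
have [M /maximal_matchingP[mM _] <-] := min_match_attained.
exact: leq_match_num.
Qed.

Lemma match_num_order : 2 * match_num G <= #|G|.
Proof.
by have [M mM <-] := match_num_attained; rewrite -card_cover_matching ?max_card.
Qed.

(** * Graphs in which every maximal matching is perfect *)

(** If [x] and [y] were not adjacent, [N] would be a maximal matching missing two vertices, hence
    one with too few edges. *)
Lemma perfect_rest_adj N x y : #|G| = 2 * min_match G -> matching N ->
    x != y -> (forall z, z \notin cover N = (z \in [set x; y])) ->
  adj x y.
Proof.
move=> perfG mN nxy covN; apply/negPn/negP => nadj.
have : maximal_matching N.
  apply/maximal_matchingP; split=> // u v uv; apply/norP.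
  rewrite !covN !inE => -[/orP[]/eqP uE /orP[]/eqP vE]; subst u v.
  - by rewrite adj_irr in uv.
  - by rewrite uv in nadj.
  - by rewrite adj_sym uv in nadj.
  - by rewrite adj_irr in uv.
move/min_match_leq; rewrite -(leq_pmul2l (isT : 0 < 2)) -perfG.
rewrite -card_cover_matching // leqNgt => /negP; apply.
rewrite -(cardsC (cover N)) -addn1 leq_add2l.
by apply/card_gt0P; exists x; rewrite inE covN set21.
Qed.

Lemma perfect_no_bridge (a b c d v : G) : #|G| = 2 * min_match G ->
    adj a b -> adj c d ->
    ~~ adj a c -> ~~ adj a d -> ~~ adj b c -> ~~ adj b d ->
  adj v b -> adj v c -> False.
Proof.
move=> perfG ab cd ac ad bc bd vb vc.
have notin2 (x y z : G) : z != x -> z != y -> z \notin [set x; y].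
  by rewrite !inE negb_or => -> ->.
have neq (x y z : G) : adj x z -> ~~ adj y z -> x != y.
  by move=> xz; apply: contraNneq => <-.
have sadj (x y : G) : adj x y -> adj y x by rewrite adj_sym.
have nsadj x y : ~~ adj x y -> ~~ adj y x by rewrite adj_sym.
have nac : a != c by apply: (neq _ _ b); last exact: nsadj.
have nad : a != d by apply: (neq _ _ b); last exact: nsadj.
have nbc : b != c by apply: (neq _ _ a); [exact: sadj | exact: nsadj].
have nbd : b != d by apply: (neq _ _ a); [exact: sadj | exact: nsadj].
have nva : v != a by apply: (neq _ _ c).
have nvd : v != d by apply: (neq _ _ b); last exact: nsadj.
have m2 : matching ([set a; b] |: [set [set c; d]]).
  apply: matchingU1 => //; last 2 first.
  - by rewrite cover1 notin2.
  - by rewrite cover1 notin2.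
  rewrite -[[set _]]setU0; apply: matchingU1 (matching0 G) _ _ _ => //.
  - by rewrite /cover big_set0 inE.
  - by rewrite /cover big_set0 inE.
have [M maxM /subsetP sM] := maxset_exists m2.
have /maximal_matchingP[mM _] := maxM.
(* Being maximal, [M] has at least [min_match G] edges, which is half the order. *)
have covM : cover M = setT.
  apply/eqP; rewrite eqEcard subsetT cardsT perfG card_cover_matching //.
  by rewrite leq_mul2l min_match_leq.
have abM : [set a; b] \in M by rewrite sM ?setU11.
have cdM : [set c; d] \in M by rewrite sM // !inE eqxx orbT.
have /bigcupP[e eM ve] : v \in cover M by rewrite covM inE.
have [w vw eE] : exists2 w, adj v w & e = [set v; w].
  have /edgesP[x [y [xy eE]]] := matching_edge mM eM.
  move: ve; rewrite eE !inE => /orP[]/eqP->; first by exists y.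
  by exists x; [exact: sadj | rewrite setUC].
rewrite {e}eE in eM ve.
(* If [w] were an end of another edge of [M], that edge would be [vw] and would contain [v]. *)
have nw x y : [set x; y] \in M -> v != x -> v != y -> (w != x) && (w != y).
  move=> xyM vx vy; rewrite -negb_or; apply: contraL isT => wxy.
  have /setP/(_ v) : [set v; w] = [set x; y].
    by apply: (matching_inj (z := w) mM) => //; rewrite ?inE ?eqxx ?orbT.
  by rewrite !inE eqxx (negPf vx) (negPf vy).
have [nwa nwb] := andP (nw _ _ abM nva (adj_neq vb)).
have [nwc nwd] := andP (nw _ _ cdM (adj_neq vc) nvd).
(* [N] misses exactly the six vertices [a], [b], [c], [d], [v], [w], so any two disjoint edges on
   them may be put back. *)
pose N := M :\ [set a; b] :\ [set c; d] :\ [set v; w].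
have neqs x y (e : {set G}) : x \notin e -> [set x; y] != e.
  by apply: contraNneq => <-; rewrite set21.
have sNM : N \subset M.
  by do 2![apply: subset_trans (subsetDl _ _) _]; exact: subsetDl.
have mN := matchingS sNM mM.
have tD (P Q : {set {set G}}) : trivIset P -> trivIset (P :\: Q).
  exact/trivIsetS/subsetDl.
have /andP[_ tM] := mM.
(* A pair of equations rewrites both orientations; [E] collects all fifteen disequalities among the
   six vertices. *)
have ne (x y : G) : x != y -> (x == y = false) * (y == x = false).
  by move/negPf=> xy; rewrite [y == x]eq_sym.
pose E := (ne _ _ nac, ne _ _ nad, ne _ _ nbc, ne _ _ nbd,
  ne _ _ nva, ne _ _ nvd, ne _ _ nwa, ne _ _ nwb, ne _ _ nwc, ne _ _ nwd,
  ne _ _ (adj_neq ab),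
  ne _ _ (adj_neq cd), ne _ _ (adj_neq vb), ne _ _ (adj_neq vc),
  ne _ _ (adj_neq vw)).
have covN z : (z \in cover N) =
    ~~ [|| z == a, z == b, z == c, z == d, z == v | z == w].
  rewrite !coverD1 ?covM ?tD // ?inE ?cdM ?eM ?neqs ?inE ?E //=.
  by rewrite !negb_or; do ![case: (_ == _)].
(* However the six vertices are listed, adding the edges on the first two pairs to [N] leaves only
   [s] and [t] uncovered, and these must be adjacent. *)
have swap (x y x' y' s t : G) : uniq [:: x; y; x'; y'; s; t] ->
    [:: x; y; x'; y'; s; t] =i [:: a; b; c; d; v; w] ->
    adj x y -> adj x' y' -> adj s t.
  rewrite /= !inE !negb_or => /and5P[/and5P[nxy nxx' nxy' nxs nxt]].
  case/and4P=> nyx' nyy' nys nyt /and3P[nx'y' nx's nx't] /andP[ny's ny't].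
  rewrite andbT => nst perm_ xy xy'.
  have covN' z : (z \in cover N) = (z \notin [:: x; y; x'; y'; s; t]).
    by rewrite perm_ covN !inE.
  have mN1 : matching ([set x'; y'] |: N).
    by apply: matchingU1 => //; rewrite covN' !inE eqxx ?orbT.
  have mN2 : matching ([set x; y] |: ([set x'; y'] |: N)).
    by apply: matchingU1 => //;
      rewrite mem_coverU1 covN' !inE eqxx ?orbT /= orbF negb_or ?nxx' ?nyx'.
  apply: (perfect_rest_adj perfG mN2 nst) => z.
  rewrite !mem_coverU1 covN' !inE !negb_or.
  have [->|] := eqVneq z s.
    by rewrite !(ne _ _ nxs, ne _ _ nys, ne _ _ nx's, ne _ _ ny's) /= ?orbT.
  have [->|] := eqVneq z t.
    by rewrite !(ne _ _ nxt, ne _ _ nyt, ne _ _ nx't, ne _ _ ny't) /= ?orbT.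
  by rewrite !orbF; do ![case: (_ == _)].
(* The edges [vc] and [ab] leave [d] and [w]. *)
have dw : adj d w.
  apply: (swap v c a b) => // [|z]; first by rewrite /= !inE !E.
  by rewrite !inE; do ![case: (_ == _)].
(* The edges [vb] and [dw] leave [a] and [c], which are not adjacent. *)
have /negP[] := ac; apply: (swap v b d w) => // [|z].
  by rewrite /= !inE !E.
by rewrite !inE; do ![case: (_ == _)].
Qed.

Lemma connect_adj_sym : connect_sym (@adj G).
Proof. by apply: sym_connect_sym; exact: adj_sym. Qed.

Lemma perfect_ind_match : #|G| = 2 * min_match G -> connected G ->
  ind_match G <= 1.
Proof.
move=> perfG /andP[_ /forallP conG]; rewrite leqNgt; apply/negP.
have [M /induced_matchingP[mM indM] <-] := ind_match_attained.
case/card_gt1P=> e [f [eM fM nef]].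
have /edgesP[a [b [ab eE]]] := matching_edge mM eM.
have /edgesP[c [d [cd fE]]] := matching_edge mM fM.
have nadj x y : x \in e -> y \in f -> ~~ adj x y.
  by move=> xe yf; apply: contra nef => xy; apply/eqP/(indM _ _ x y).
(* [P] collects the vertices on edges whose two ends are both nonadjacent to [c] and [d]. It
   contains [a] but not [c], so connectivity is contradicted once [P] is closed under adjacency. *)
pose far := [pred z | ~~ adj z c & ~~ adj z d].
pose P := [pred x | [exists y, [&& adj x y, far x & far y]]].
have Pa : a \in P.
  by apply/existsP; exists b; rewrite ab /= !nadj // ?eE ?fE !inE ?eqxx ?orbT.
have clP : closed (@adj G) P.
  apply: intro_closed; first exact: connect_adj_sym.
  move=> x v xv /existsP[y /and3P[xy /andP[xc xd] /andP[yc yd]]].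
  (* If [v] were [far], the edge [vx] would put it in [P]. Otherwise [v] is adjacent to [c] or [d]
     and bridges the edges [yx] and [cd]. *)
  apply: contraT => /existsPn/(_ x); rewrite adj_sym xv /= xc xd !andbT.
  rewrite negb_and !negbK => vcd; have vx : adj v x by rewrite adj_sym.
  have yx : adj y x by rewrite adj_sym.
  have dc : adj d c by rewrite adj_sym.
  case/orP: vcd => vcd.
    by case: (perfect_no_bridge perfG yx cd yc yd xc xd vx vcd).
  by case: (perfect_no_bridge perfG yx dc yd yc xd xc vx vcd).
have := closed_connect clP (forallP (conG a) c); rewrite Pa => /esym/existsP[y].
by rewrite /= cd /= !andbF.
Qed.
End Matchings.

(** * Even cliques joined to an independent set: order, connectivity and induced matchings *)

Section CliquesJoin.
Variables q k s : nat.

(* For [k < q] there are [k.+1] cliques, and all but the last have order 2. *)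
Definition cj_class (x : 'I_q * bool) : nat := minn x.1 k.

(** The summand ['I_s] is the independent set. Since [cj_class] depends only on the first
    coordinate, each clique is a union of pairs and has even order. *)
Definition cj_adj (u v : 'I_q * bool + 'I_s) : bool :=
  match u, v with
  | inl x, inl y => (x != y) && (cj_class x == cj_class y)
  | inr _, inr _ => false
  | _, _ => true
  end.

Lemma cj_adj_sym : symmetric cj_adj.
Proof. by move=> [x|i] [y|j] //=; rewrite eq_sym [cj_class x == _]eq_sym. Qed.

Lemma cj_adj_irr : irreflexive cj_adj.
Proof. by move=> [x|i] //=; rewrite eqxx. Qed.

Definition cj_graph : sgraph := SGraph cj_adj_sym cj_adj_irr.

Notation clq x := (inl x : cj_graph).
Notation ind j := (inr j : cj_graph).

Lemma cj_order : #|cj_graph| = 2 * q + s.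
Proof. by rewrite card_sum card_prod !card_ord card_bool mulnC. Qed.

(** One vertex of the independent set links all cliques; when [s = 0], the alternative [k = 0]
    leaves a single clique. *)
Lemma cj_connected : 0 < q -> (0 < s) || (k == 0) -> connected cj_graph.
Proof.
move=> q0 sk.
have symc := @connect_adj_sym cj_graph.
pose h := clq (Ordinal q0, true).
have hub u : connect (@adj cj_graph) u h.
  case: u => [x|j]; last exact: connect1.
  case/orP: sk => [s0|/eqP k0].
    apply: (@connect_trans _ _ (ind (Ordinal s0))); exact: connect1.
  have [->|nxh] := eqVneq x (Ordinal q0, true); first exact: connect0.
  by apply: connect1; rewrite /= nxh /cj_class k0 !minn0 eqxx.
apply/andP; split; first by apply/card_gt0P; exists h.
apply/forallP => u; apply/forallP => v; apply: connect_trans (hub u) _.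
by rewrite symc hub.
Qed.

(** The rungs match each clique perfectly within itself. *)
Definition rung (i : 'I_q) : {set cj_graph} :=
  [set clq (i, true); clq (i, false)].

Lemma mem_rung i x : (clq x \in rung i) = (x.1 == i).
Proof.
case: x => j b; rewrite !inE !(inj_eq inl_inj) !xpair_eqE.
by case: b; rewrite /= ?andbT ?andbF ?orbF.
Qed.

Lemma mem_rung_ind i j : (ind j \in rung i) = false.
Proof. by rewrite !inE. Qed.

Lemma rung_inj : injective rung.
Proof.
by move=> i j /setP/(_ (clq (i, true))); rewrite !mem_rung eqxx => /esym/eqP.
Qed.

Lemma rungs_matching (A : {set 'I_q}) : matching (rung @: A).
Proof.
apply: matchingI => [e|e f z].
  by case/imsetP=> i _ ->; apply: edge_adj; rewrite /= xpair_eqE andbF eqxx.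
case/imsetP=> i _ -> /imsetP[j _ ->].
case: z => [x|l]; last by rewrite mem_rung_ind.
by rewrite !mem_rung => /eqP-> /eqP->.
Qed.

(** The [q] rungs cover all cliques, and the remaining vertices are independent. *)
Lemma cj_min_match_le : min_match cj_graph <= q.
Proof.
apply: leq_trans (@min_match_leq _ (rung @: setT) _) _; last first.
  by apply: leq_trans (leq_imset_card _ _) _; rewrite cardsT card_ord.
apply/maximal_matchingP; split=> [|u v]; first exact: rungs_matching.
have cov x : clq x \in cover (rung @: setT).
  by apply/bigcupP; exists (rung x.1); rewrite ?mem_rung ?imset_f.
by case: u v => [x|i] [y|j] // _; rewrite !cov ?orbT.
Qed.

(** The rungs of index at most [k] lie in distinct cliques, because [minn i k = i] there. *)
Lemma leq_cj_ind_match : k < q -> k.+1 <= ind_match cj_graph.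
Proof.
move=> kq; pose A := [set i : 'I_q | i <= k].
have -> : k.+1 = #|rung @: A|.
  rewrite card_imset; last exact: rung_inj.
  have -> : A = [set widen_ord kq j | j in 'I_k.+1].
    apply/setP => i; rewrite inE; apply/idP/imsetP => [ik|[j _ ->]].
      by exists (Ordinal (ik : i < k.+1)) => //; apply: val_inj.
    exact: (ltn_ord j).
  by rewrite card_imset ?card_ord // => i j /(congr1 val) /= /val_inj.
apply: leq_ind_match; apply/induced_matchingP; split=> [|e f u v].
  exact: rungs_matching.
case/imsetP=> i iA -> /imsetP[j jA ->]; rewrite !inE in iA jA.
case: u => [x|?]; last by rewrite mem_rung_ind.
case: v => [y|?]; last by rewrite mem_rung_ind.
rewrite !mem_rung => /eqP xi /eqP yj /andP[_]; rewrite /cj_class xi yj.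
by move/eqP; rewrite !(minn_idPl _) // => /val_inj->.
Qed.

(* Every edge has an end in one of the cliques, and no two edges of an induced
   matching have an end in the same clique. *)
Lemma cj_ind_match_le : ind_match cj_graph <= k.+1.
Proof.
have [M /induced_matchingP[mM indM] <-] := ind_match_attained cj_graph.
rewrite -[leqRHS]card_ord.
pose R (e : {set cj_graph}) (c : 'I_k.+1) :=
  [exists x, (clq x \in e) && (cj_class x == c)].
apply: (@leq_card_rel _ _ _ R) => [e eM|e f c eM fM].
  have [x xe] : exists x, clq x \in e.
    have /edgesP[[x|i] [[y|j] [uv ->]]] := matching_edge mM eM => //.
    - by exists x; rewrite set21.
    - by exists x; rewrite set21.
    - by exists y; rewrite set22.
  have xk : cj_class x < k.+1 by rewrite ltnS geq_minr.
  by exists (Ordinal xk); apply/existsP; exists x; rewrite xe eqxx.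
case/existsP=> x /andP[xe /eqP xc] /existsP[y /andP[yf /eqP yc]].
have [exy|nxy] := eqVneq x y.
  by apply: (matching_inj (z := clq x) mM) => //; rewrite exy.
by apply: (indM e f (clq x) (clq y)) => //=; rewrite nxy xc yc eqxx.
Qed.

(** * Perfect and minimum maximal matchings of the clique join *)

(** Number the clique vertices by [2i + b]. The first [s] are matched in order with the independent
    set, the others with their twins in the same rung. Evenness of [s] prevents a rung from being
    split. *)
Lemma cj_match_num_even : ~~ odd s -> s <= 2 * q ->
  2 * q + s <= 2 * match_num cj_graph.
Proof.
move=> s_even sq.
(* [insub] succeeds exactly when the number of [x] is below [s]; the boolean counts as 0 or 1. *)
pose f (x : 'I_q * bool) : cj_graph :=
  if insub (x.1.*2 + x.2) is Some j then ind j else clq (x.1, ~~ x.2).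
pose E x : {set cj_graph} := [set clq x; f x].
have mE : matching [set E x | x in setT].
  have lts (x : 'I_q * bool) : (x.1.*2 + x.2 < s) = (x.1 < s./2).
    rewrite -[s in LHS]odd_double_half (negPf s_even) add0n.
    by case: x => i []; rewrite /= ?addn0 ?ltn_double // addn1 ltn_Sdouble.
  have fP (x : 'I_q * bool) : (exists2 j : 'I_s, x.1.*2 + x.2 = j & f x = ind j)
      \/ (s./2 <= x.1 /\ f x = clq (x.1, ~~ x.2)).
    rewrite /f; case: insubP => [j _ jE|]; first by left; exists j.
    by rewrite lts -leqNgt; right.
  have Etwin (x w : 'I_q * bool) : clq w \in E x -> E x = E w.
    rewrite !inE => /orP[/eqP[->] //|/eqP wf].
    case: (fP x) => [[j _ fj]|[tx fx]]; first by rewrite fj in wf.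
    have [wE] : clq w = clq (x.1, ~~ x.2) by rewrite wf.
    rewrite /E fx wE; case: (fP (x.1, ~~ x.2)) => [[j /= jE _]|[_ ->]].
      by have := ltn_ord j; rewrite -jE (lts (x.1, ~~ x.2)) ltnNge tx.
    by rewrite /= negbK -surjective_pairing setUC.
  apply: matchingI => [e|e e' z].
    case/imsetP=> x _ ->; apply: edge_adj.
    case: (fP x) => [[j _ ->]//|[_ ->]] /=.
    by rewrite /cj_class eqxx andbT; case: x => i []; rewrite xpair_eqE andbF.
  case/imsetP=> x _ -> /imsetP[y _ ->]; case: z => [w|j] zx zy.
    by rewrite (Etwin _ _ zx) (Etwin _ _ zy).
  (* The partner [w] of [j] is recovered from [j] as its half and its parity. *)
  have val_j (w : 'I_q * bool) : ind j \in E w -> nat_of_ord j = w.2 + w.1.*2.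
    rewrite !inE /= => /eqP jf.
    case: (fP w) => [[l lE fl]|[_ fw]]; last by rewrite fw in jf.
    have [->] : ind j = ind l by rewrite jf.
    by rewrite -lE addnC.
  have := val_j _ zx; rewrite (val_j _ zy).
  case: x y {zx zy} => [i b] [l c] /= lb.
  have li : l = i.
    by apply: val_inj; rewrite /= -(half_bit_double l c) lb half_bit_double.
  by move: lb; rewrite li => /addIn; case: b c => [] [].
apply: leq_trans (_ : 2 * #|[set E x | x in setT]| <= _); last first.
  by rewrite leq_mul2l leq_match_num.
rewrite -card_cover_matching // -cj_order -cardsT subset_leq_card //.
apply/subsetP => u _; case: u => [x|j].
  by apply/bigcupP; exists (E x); rewrite ?imset_f ?set21.
(* Here [s <= 2 * q] ensures that every independent vertex receives a partner. *)
have jq : j./2 < q.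
  rewrite ltn_half_double -mul2n; exact: leq_trans sq.
apply/bigcupP; exists (E (Ordinal jq, odd j)); rewrite ?imset_f //.
rewrite !inE /f /= addnC odd_double_half insubT //= => js.
by apply/eqP; congr inr; apply: val_inj.
Qed.

Lemma leq_cj_min_match : q <= min_match cj_graph.
Proof.
have [M maxM <-] := min_match_attained cj_graph.
have /maximal_matchingP[mM cov] := maxM.
rewrite -(leq_pmul2l (isT : 0 < 2)) -card_cover_matching //.
pose U := ~: cover M.
have indU u v : u \in U -> v \in U -> ~~ adj u v.
  rewrite !inE => uM vM; apply/negP => /cov.
  by rewrite (negPf uM) (negPf vM).
(* The order is [2 * q + s], so missing at most [s] vertices means covering at least [2 * q]. *)
suff leU : #|U| <= s.
  by rewrite -(leq_add2r s) -cj_order -(cardsC (cover M)) leq_add2l.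
rewrite -[leqRHS]card_ord.
(* An uncovered independent vertex is adjacent to all clique vertices, so [U] then lies in the
   independent set. *)
have [/existsP[j jU]|noI] := boolP [exists j, ind j \in U].
  apply: (@leq_card_rel _ _ _ (fun u i => u == ind i)) => [u uU|];
    last by move=> u v i _ _ /eqP-> /eqP->.
  case: u uU => [x|i] uU.
    by have := indU _ _ uU jU.
  by exists i.
(* Otherwise, an uncovered clique vertex is related to [j] when an edge of [M] joins its clique to
   [j]. One [j] determines the edge, hence the clique, which contains at most one uncovered
   vertex. *)
pose R (u : cj_graph) (j : 'I_s) := if u is inl x then
    [exists y, (cj_class x == cj_class y) && ([set clq y; ind j] \in M)]
  else false.
apply: (@leq_card_rel _ _ _ R) => [u uU|]; last first.
  move=> [x|?] [y|?] j //= xU yU /existsP[x' /andP[/eqP xx' x'M]].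
  case/existsP=> y' /andP[/eqP yy' y'M].
  have := indU _ _ xU yU.
  suff ee : x' = y' by rewrite /= xx' yy' ee eqxx andbT negbK => /eqP->.
  have ee := matching_inj (z := ind j) mM x'M y'M (set22 _ _) (set22 _ _).
  by have := set21 (clq x') (ind j); rewrite ee !inE orbF => /eqP[].
case: u uU => [x|j] uU; last by case/existsP: noI; exists j.
(* If no edge of [M] leaves the clique [K] of [x], the edges meeting [K] cover exactly [K] without
   [x], a set of odd order. *)
apply/existsP; apply: contraT => /existsPn noR.
pose K : {set cj_graph} :=
  [set clq y | y in [pred y | cj_class y == cj_class x]].
have memK y : (clq y \in K) = (cj_class y == cj_class x).
  by rewrite mem_imset // => a b [].
have evenK : odd #|K| = false.
  rewrite card_imset; last by move=> a b [].
  have -> : #|[pred y | cj_class y == cj_class x]| =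
      #|setX [set i : 'I_q | minn i k == cj_class x] [set: bool]|.
    by apply: eq_card => -[i b]; rewrite !inE andbT.
  by rewrite cardsX cardsT card_bool oddM andbF.
pose M' := [set e in M | [exists u in K, u \in e]].
have sM' : M' \subset M by apply/subsetP => e; rewrite inE => /andP[].
have covM' : cover M' = K :\ clq x.
  apply/setP => u; rewrite in_setD1; apply/bigcupP/andP.
    case=> e; rewrite inE => /andP[eM /existsP[v /andP[vK ve]]] ue.
    have nux : u != clq x.
      apply: contraTneq uU => ux; rewrite inE negbK; apply/bigcupP.
      by exists e; rewrite // -ux.
    split=> //; have [->//|nuv] := eqVneq u v.
    have [auv eE] := edge_ends (matching_edge mM eM) ue ve nuv.
    case/imsetP: vK => y; rewrite inE => /eqP yx vE; subst v.
    case: u auv eE {ue nuv nux} => [z /andP[_ /eqP zy] _|j _ eE].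
      by rewrite memK zy yx.
    have /negP[] := noR j.
    by apply/existsP; exists y; rewrite yx eqxx setUC -eE eM.
  case=> nux uK; have uM : u \in cover M.
    case/imsetP: uK => y; rewrite inE => cyx uE; subst u.
    apply: contraT => yU; have := indU (clq y) (clq x).
    rewrite !inE yU /= cyx andbT negbK.
    by rewrite inE in uU; move=> /(_ isT uU)/eqP yx; rewrite yx eqxx in nux.
  case/bigcupP: uM => e eM ue; exists e => //; rewrite inE eM.
  by apply/existsP; exists u; rewrite uK.
have := card_cover_matching (matchingS sM' mM); rewrite covM' => cK'.
by move: evenK; rewrite (cardsD1 (clq x)) memK eqxx cK' oddD oddM.
Qed.

Lemma cj_min_match : min_match cj_graph = q.
Proof. by apply/eqP; rewrite eqn_leq cj_min_match_le leq_cj_min_match. Qed.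

Lemma cj_ind_match : k < q -> ind_match cj_graph = k.+1.
Proof.
by move=> kq; apply/eqP; rewrite eqn_leq cj_ind_match_le leq_cj_ind_match.
Qed.

End CliquesJoin.

(** * Realizations and the minimum orders *)

(** With [s = 2 * (r - q)] the order is [2 * r] and a perfect matching exists. The last hypothesis
    gives connectivity: either [s > 0] or there is a single clique. *)
Lemma realized_order_even p q r : 0 < p <= q -> q <= r <= 2 * q ->
  (q < r) || (p == 1) -> realized_order p q r (2 * r).
Proof.
case: p => // k /= kq /andP[qr rq] conn.
have ordE : 2 * q + 2 * (r - q) = 2 * r by rewrite -mulnDr subnKC.
exists (cj_graph q k (2 * (r - q))); split.
- apply: cj_connected; first exact: leq_trans kq.
  by rewrite muln_gt0 subn_gt0.
- exact: cj_ind_match.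
- exact: cj_min_match.
- apply/eqP; rewrite -(eqn_pmul2l (isT : 0 < 2)) eqn_leq -ordE.
  rewrite -{1}(cj_order q k) match_num_order cj_match_num_even //.
    by rewrite mul2n odd_double.
  by rewrite leq_mul2l leq_subLR addnn -mul2n.
- by rewrite cj_order.
Qed.

(** With [s = 1] the order [2 * q + 1] bounds the matching number by [q], and the minimum maximal
    matching already has [q] edges. *)
Lemma realized_order_odd p q : 0 < p <= q -> realized_order p q q (2 * q + 1).
Proof.
case: p => // k /= kq; exists (cj_graph q k 1); split.
- by apply: cj_connected; first exact: leq_trans kq.
- exact: cj_ind_match.
- exact: cj_min_match.
- have := min_match_le_match_num (cj_graph q k 1); rewrite cj_min_match => qm.
  apply/eqP; rewrite eqn_leq qm andbT.
  have := match_num_order (cj_graph q k 1).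
  by rewrite cj_order addn1 !mul2n leq_Sdouble.
- exact: cj_order.
Qed.

Lemma realized_order_lower p q r n : realized_order p q r n -> 2 * r <= n.
Proof. by case=> G [_ _ _ <- <-]; exact: match_num_order. Qed.

Theorem theorem2p1 (p q r : nat) (hp : 1 <= p) (hpq : p <= q) (hqr : q <= r)
    (hr : r <= 2 * q) :
  [/\ is_min_order 1 q r (2 * r),
      2 <= p <= q -> q < r <= 2 * q -> is_min_order p q r (2 * r)
    & 2 <= p <= q -> q = r -> is_min_order p r r (2 * r + 1)].
Proof.
have q_gt0 : 0 < q := leq_trans hp hpq.
split=> [|_ /andP[ltqr _]|/andP[p_gt1 _] eqr].
- split; last by move=> m /realized_order_lower.
  by apply: realized_order_even; rewrite ?q_gt0 ?hqr ?hr ?orbT.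
- split; last by move=> m /realized_order_lower.
  by apply: realized_order_even; rewrite ?hp ?hpq ?hqr ?hr ?ltqr.
- split; first by apply: realized_order_odd; rewrite hp -eqr.
  (* Order exactly [2 * r] would make all maximal matchings perfect, forcing induced matching number
     at most 1. *)
  move=> m rm; rewrite addn1 ltn_neqAle (realized_order_lower rm) andbT.
  case: rm => G [conG indG minG _ <-]; apply: contraL p_gt1 => /eqP perfG.
  by rewrite -leqNgt -indG perfect_ind_match // minG.
Qed.
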